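(* Let $q>1$ be real. Then: (i) for each $r\in(1,q)$, the set $$G_{r,q}:=\Bigl\{\sum_{i=1}^\infty \frac{b_i(x,r)}{q^i}: x\in J_r\Bigr\}$$ has Hausdorff dimension $\log r/\log q$; (ii) the set $G_q:=\bigcup_{r\in(1,q)}G_{r,q}$ is of first category, has Lebesgue measure zero and has Hausdorff dimension one.
   Context: For real $p>1$ let $\lceil p\rceil$ be the smallest integer $\ge p$, $A_p=\{0,\ldots,\lceil p\rceil-1\}$ and $J_p=[0,(\lceil p\rceil-1)/(p-1)]$. For $x\in J_p$ the greedy expansion $(b_i(x,p))$ of $x$ in base $p$ is defined recursively: $b_n(x,p)$ is the largest element of $A_p$ with $\sum_{i=1}^n b_i(x,p)p^{-i}\le x$; it satisfies $x=\sum_i b_i(x,p)p^{-i}$. *)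

(* Defs.v *)
From HB Require Import structures.
From mathcomp Require Import all_boot all_order all_algebra.
From mathcomp Require Import all_classical all_reals all_analysis.
Set Implicit Arguments. Unset Strict Implicit. Unset Printing Implicit Defensive.
Import Order.TTheory GRing.Theory Num.Theory.
Import numFieldNormedType.Exports.
Local Open Scope classical_set_scope.
Local Open Scope ring_scope.

Section Defs.
Variable R : realType.

(** ceil p as a natural number (p > 1 in all uses, so ceil p >= 2) *)
Definition ceilp (p : R) : nat := `|Num.ceil p|%N.

Definition Jp (p : R) : set R :=
  [set x | 0 <= x <= ((ceilp p)%:R - 1) / (p - 1)].

Definition digits_val (p : R) (s : seq nat) : R :=
  \sum_(i < size s) (nth 0%N s i)%:R / p ^+ i.+1.

Definition greedy_next (p x : R) (s : seq nat) : nat :=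
  \max_(k < ceilp p | digits_val p (rcons s k) <= x) (k : nat).

Fixpoint greedy_prefix (p x : R) (n : nat) : seq nat :=
  match n with
  | 0 => [::]
  | n.+1 => let s := greedy_prefix p x n in rcons s (greedy_next p x s)
  end.

(** greedy digit b_{n+1}(x,p) (0-based index: greedy_digit p x n = b_{n+1}) *)
Definition greedy_digit (p x : R) (n : nat) : nat :=
  nth 0%N (greedy_prefix p x n.+1) n.

Definition Grq (r q : R) : set R :=
  [set y | exists2 x, Jp r x &
     y = limn (series (fun i => (greedy_digit r x i)%:R / q ^+ i.+1))].

Definition Gq (q : R) : set R :=
  \bigcup_(r in [set r : R | 1 < r < q]) Grq r q.

Definition rdiam (U : set R) : R := sup [set `|x - y| | x in U & y in U].

Definition delta_cover (delta : R) (A : set R) (U : nat -> set R) : Prop :=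
  A `<=` \bigcup_n U n /\
  forall n x y, U n x -> U n y -> `|x - y| <= delta.

Definition hausdorff_content (s delta : R) (A : set R) : \bar R :=
  ereal_inf [set (\sum_(0 <= n <oo) ((rdiam (U n)) `^ s)%:E)%E
            | U in delta_cover delta A].

(** H^s(A) = lim_{delta -> 0} H^s_delta(A) = sup_{delta > 0} H^s_delta(A) *)
Definition hausdorff_measure (s : R) (A : set R) : \bar R :=
  ereal_sup [set hausdorff_content s delta A | delta in [set d : R | 0 < d]].

Definition hausdorff_dim (A : set R) : R :=
  inf [set s : R | 0 <= s /\ hausdorff_measure s A = 0%E].

Definition nowhere_dense (A : set R) : Prop := (closure A)° = set0.

Definition first_category (A : set R) : Prop :=
  exists F : nat -> set R,
    A `<=` \bigcup_n F n /\ forall n, nowhere_dense (F n).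

End Defs.

(* Main.v *)
(** Order digit sequences lexicographically.  If [a] and [b] are greedy in base
    [p], first differ at place [k] and [a] is the smaller one, then the tail of
    [a] after [k] has base-[p] value at most 1, hence base-[t] value at most
    [p / t < 1] for every [t > p]; so the base-[t] values of [a] and [b] differ
    by at least [(1 - p / t) / t ^ k], while in any base [u] they differ by
    [O(u ^ - k)].  Passing from base-[t] to base-[u] values is thus Hölder of
    exponent [ln u / ln t].
    With [t = q] and [u = r], the set [Grq r q] is mapped onto a superset of
    [[0, 1]] by an [ln r / ln q]-Hölder map, which bounds its dimension below.
    With [u = q] and [t] slightly above [r], it is the image of a bounded set,
    so it is covered by [N] intervals of length [O(N ^ - (ln q / ln t))], which
    bounds the dimension above.  As this exponent can be taken above 1, the
    closure of such a set is null; [Gq q] lies in a countable union of them. *)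
Require Import Defs.
From HB Require Import structures.
From mathcomp Require Import all_boot all_order all_algebra.
From mathcomp Require Import all_classical all_reals all_analysis.
From mathcomp Require Import measurable_realfun ring lra.
Import Order.TTheory GRing.Theory Num.Theory.
Import numFieldNormedType.Exports.
Local Open Scope classical_set_scope.
Local Open Scope ring_scope.

Set Implicit Arguments.
Unset Strict Implicit.
Unset Printing Implicit Defensive.

(** * Values of digit sequences *)

(** The base [t] is decoupled from the base in which [a] is an expansion: the points of [Grq r q]
    are the values [qval q (greedy_digit r x)], and the same digits give back [x] in base [r]. *)
Definition qval {R : realType} (t : R) (a : nat -> nat) : R :=
  limn (series (fun i => (a i)%:R / t ^+ i.+1)).

Lemma psum_recl (R : realType) (t : R) (a : nat -> nat) n : t != 0 ->
  series (fun i => (a i)%:R / t ^+ i.+1) n.+1 =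
  ((a 0%N)%:R + series (fun i => (a i.+1)%:R / t ^+ i.+1) n) / t.
Proof.
move=> t0; rewrite /series /= !big_mkord big_ord_recl expr1 mulrDl mulr_suml.
congr (_ + _); apply: eq_bigr => i _.
by rewrite [t ^+ i.+2]exprSr invfM mulrA.
Qed.

(** $M/(t-1)$ is the fixed point of $y \mapsto (M+y)/t$, so the bound survives peeling off the first
    digit. *)
Lemma psum_le (R : realType) (t : R) M (a : nat -> nat) n : 1 < t ->
  (forall i, a i <= M)%N ->
  series (fun i => (a i)%:R / t ^+ i.+1) n <= M%:R / (t - 1).
Proof.
move=> t1; have t1' : 0 < t - 1 by rewrite subr_gt0.
elim: n a => [|n IH] a aM.
  by rewrite /series /= big_geq// divr_ge0// ltW.
rewrite psum_recl ?gt_eqF ?(lt_trans ltr01 t1)//.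
rewrite ler_pdivrMr ?(lt_trans ltr01 t1)//.
have -> : M%:R / (t - 1) * t = M%:R + M%:R / (t - 1).
  by field; rewrite gt_eqF.
by rewrite lerD ?ler_nat// IH.
Qed.

Lemma psum_cvg (R : realType) (t : R) M (a : nat -> nat) : 1 < t ->
  (forall i, a i <= M)%N -> cvgn (series (fun i => (a i)%:R / t ^+ i.+1)).
Proof.
move=> t1 aM; apply: nondecreasing_is_cvgn.
  apply/nondecreasing_seqP => n; rewrite seriesSr lerDl divr_ge0// exprn_ge0//.
  by rewrite ltW// (lt_trans ltr01 t1).
by exists (M%:R / (t - 1)) => _ [n _ <-]; exact: psum_le.
Qed.

Lemma qval_ge0 (R : realType) (t : R) M (a : nat -> nat) : 1 < t ->
  (forall i, a i <= M)%N -> 0 <= qval t a.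
Proof.
move=> t1 aM; apply: limr_ge; first exact: psum_cvg aM.
near=> n; rewrite /series /=; apply: sumr_ge0 => i _.
by rewrite divr_ge0// exprn_ge0// ltW// (lt_trans ltr01 t1).
Unshelve. all: by end_near. Qed.

Lemma qval_le (R : realType) (t : R) M (a : nat -> nat) : 1 < t ->
  (forall i, a i <= M)%N -> qval t a <= M%:R / (t - 1).
Proof.
move=> t1 aM; apply: limr_le; first exact: psum_cvg aM.
by near=> n; exact: psum_le.
Unshelve. all: by end_near. Qed.

Lemma qval_recl (R : realType) (t : R) M (a : nat -> nat) : 1 < t ->
  (forall i, a i <= M)%N ->
  qval t a = ((a 0%N)%:R + qval t (fun i => a i.+1)) / t.
Proof.
move=> t1 aM; apply: cvg_lim => //; rewrite -cvg_shiftS.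
under eq_fun do rewrite psum_recl ?gt_eqF ?(lt_trans ltr01 t1)//.
apply: cvgMr_tmp; apply: cvgD; first exact: cvg_cst.
by apply: (@psum_cvg _ _ M).
Qed.

(** The exponents start at 1, and $(p/t)^{i+1} \le p/t$ for every $i \ge 0$. *)
Lemma qval_base (R : realType) (p t : R) M (a : nat -> nat) : 1 < p -> p <= t ->
  (forall i, a i <= M)%N -> qval t a <= p / t * qval p a.
Proof.
move=> p1 pt aM; have t1 := lt_le_trans p1 pt.
have p0 := lt_trans ltr01 p1; have t0 := lt_trans ltr01 t1.
have ps_ge0 n (b : nat -> nat) :
    0 <= series (fun i => (b i)%:R / p ^+ i.+1) n.
  by apply: sumr_ge0 => i _; rewrite divr_ge0// exprn_ge0// ltW.
have le_ps n : forall b : nat -> nat,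
    series (fun i => (b i)%:R / t ^+ i.+1) n <=
    p / t * series (fun i => (b i)%:R / p ^+ i.+1) n.
  elim: n => [|n IH] b; first by rewrite /series/= !big_geq// mulr0.
  rewrite !psum_recl ?gt_eqF//.
  have -> (x y : R) : p / t * ((x + y) / p) = (x + y) / t.
    by field; rewrite !gt_eqF.
  rewrite ler_pM2r ?invr_gt0// lerD2l (le_trans (IH _))//.
  by rewrite ler_piMl// ler_pdivrMr// mul1r.
have cp := psum_cvg p1 aM.
rewrite /qval -(cvg_lim _ (cvgMl_tmp (a:=p / t) cp))//.
apply: ler_lim; [exact: psum_cvg aM|by apply: is_cvgMl_tmp|].
by near=> n; exact: le_ps.
Unshelve. all: by end_near. Qed.

(** The tail condition is the greedy one with [<= 1] in place of [< 1], which
    makes it monotone in the base (lemma [adm_base]). *)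
Definition adm (R : realType) (M : nat) (p : R) (a : nat -> nat) : Prop :=
  (forall i, a i <= M)%N /\
  forall k, (a k < M)%N -> qval p (fun j => a (k.+1 + j)%N) <= 1.

(** Each common leading digit costs a factor $1/t$. At the first difference [b] gains at least 1,
    its tail is nonnegative, and the tail of [a] is worth at most $p/t$ by [qval_base]. *)
Lemma adm_sep (R : realType) (M : nat) (p t : R) k (a b : nat -> nat) :
  1 < p -> p < t -> adm M p a -> (forall i, b i <= M)%N ->
  (forall i, (i < k)%N -> a i = b i) -> (a k < b k)%N ->
  (1 - p / t) / t ^+ k.+1 <= qval t b - qval t a.
Proof.
move=> p1 pt; have t1 := lt_trans p1 pt; have t0 := lt_trans ltr01 t1.
elim: k a b => [|k IH] a b [aM aP] bM ab abk.
  rewrite (qval_recl t1 aM) (qval_recl t1 bM) -mulrBl expr1.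
  rewrite ler_pM2r ?invr_gt0//.
  have H1 : qval t (fun i => a i.+1) <= p / t.
    apply: le_trans (@qval_base _ p t M _ p1 (ltW pt) _) _ => //.
    rewrite ler_piMr//; first by rewrite divr_ge0//; lra.
    by apply: (aP 0%N); exact: leq_trans (bM 0%N).
  have H2 : 0 <= qval t (fun i => b i.+1) by apply: (@qval_ge0 _ _ M).
  have H3 : (a 0)%:R + 1 <= (b 0)%:R :> R by rewrite natr1 ler_nat.
  lra.
rewrite (qval_recl t1 aM) (qval_recl t1 bM) -mulrBl exprSr invfM mulrA.
rewrite ler_pM2r ?invr_gt0// ab// opprD addrACA subrr add0r.
apply: IH => // [|i ik]; last exact: ab.
by split=> // j; exact: (aP j.+1).
Qed.

(** After the common prefix both tails have values in $[0, M/(u-1)]$, scaled by $u^{-k}$. *)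
Lemma qval_dist_le (R : realType) (M : nat) (u : R) k (a b : nat -> nat) :
  1 < u -> (forall i, a i <= M)%N -> (forall i, b i <= M)%N ->
  (forall i, (i < k)%N -> a i = b i) ->
  `|qval u a - qval u b| <= M%:R / (u - 1) / u ^+ k.
Proof.
move=> u1; have u0 := lt_trans ltr01 u1.
elim: k a b => [|k IH] a b aM bM ab.
  have := qval_ge0 u1 aM; have := qval_ge0 u1 bM.
  have := qval_le u1 aM; have := qval_le u1 bM.
  rewrite expr0 divr1 ler_norml; lra.
rewrite (qval_recl u1 aM) (qval_recl u1 bM) -mulrBl exprSr invfM mulrA.
rewrite normrM [X in _ * X]gtr0_norm ?invr_gt0// ler_pM2r ?invr_gt0//.
by rewrite ab// opprD addrACA subrr add0r; apply: IH => // i ik; exact: ab.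
Qed.

Lemma powR_log (R : realType) (t u : R) : 1 < t -> 0 < u ->
  t `^ (ln u / ln t) = u.
Proof.
move=> t1 u0; rewrite /powR gt_eqF ?(lt_trans ltr01 t1)//.
by rewrite divfK ?lnK// gt_eqF// ln_gt0.
Qed.

Lemma adm_holder (R : realType) (M : nat) (p t u : R) :
  1 < p -> p < t -> 1 < u ->
  exists2 C : R, 0 < C & forall a b, adm M p a -> adm M p b ->
    `|qval u a - qval u b| <= C * `|qval t a - qval t b| `^ (ln u / ln t).
Proof.
move=> p1 pt u1; have t1 := lt_trans p1 pt.
have [t0 u0] := (lt_trans ltr01 t1, lt_trans ltr01 u1).
set al := ln u / ln t; set c := 1 - p / t.
have al0 : 0 < al by rewrite divr_gt0// ln_gt0.
have c0 : 0 < c by rewrite subr_gt0 ltr_pdivrMr// mul1r.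
have c'0 : 0 < c `^ al by rewrite powR_gt0.
(* [M.+1] keeps [C] positive when [M] is 0; the factor [u] turns $u^{-(k+1)}$ into $u^{-k}$; the
   divisor comes from the separation constant [c] raised to the power [al]. *)
pose C := M.+1%:R / (u - 1) * u / c `^ al.
have u1' : 0 < u - 1 by rewrite subr_gt0.
have C0 : 0 < C by rewrite !(divr_gt0, mulr_gt0).
exists C => [//|a b Ha Hb].
(* By symmetry of the distance it is enough to treat the first place of difference [k] with the
   smaller digit in [a']. *)
suff key k a' b' : adm M p a' -> adm M p b' ->
    (forall i, (i < k)%N -> a' i = b' i) -> (a' k < b' k)%N ->
    `|qval u b' - qval u a'| <= C * `|qval t b' - qval t a'| `^ al.
  have [->|nab] := pselect (a = b).
    by rewrite subrr normr0 mulr_ge0 ?powR_ge0// ltW.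
  have ex : exists k, a k != b k.
    by apply: contrapT => /forallNP H; apply: nab; apply/funext => k;
       apply/eqP/negPn/negP; exact: H.
  have [] := ltngtP (a (ex_minn ex)) (b (ex_minn ex)).
  - case: ex_minnP => k _ kmin ltk; rewrite distrC [X in _ * X `^ _]distrC.
    apply: key ltk => // i ik; apply/eqP/negPn/negP => /kmin.
    by rewrite leqNgt ik.
  - case: ex_minnP => k _ kmin ltk.
    apply: key ltk => // i ik; apply/eqP/negPn/negP.
    by rewrite eq_sym => /kmin; rewrite leqNgt ik.
  - by case: ex_minnP => k /eqP.
move=> {}Ha {}Hb ab ltk.
have := adm_sep p1 pt Ha Hb.1 ab ltk; rewrite -/c => sep.
have lb : c / t ^+ k.+1 <= `|qval t b' - qval t a'|.
  by rewrite (le_trans sep)// ler_norm.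
have T0 : 0 < t ^+ k.+1 by rewrite exprn_gt0.
(* The exponent [al] is chosen so that $t^{al} = u$: the separation scale in base [t] becomes the
   distance scale in base [u]. *)
have tal : (t ^+ k.+1) `^ al = u ^+ k.+1.
  by rewrite -powR_mulrn ?ltW// -powRrM mulrC powRrM powR_log// powR_mulrn// ltW.
have lb' : c `^ al / u ^+ k.+1 <= `|qval t b' - qval t a'| `^ al.
  rewrite -{1}[c](@divfK _ (t ^+ k.+1)) ?gt_eqF// powRM ?divr_ge0 ?(ltW c0) ?(ltW T0)//.
  rewrite tal mulfK ?gt_eqF ?exprn_gt0//.
  by apply: ge0_ler_powR; rewrite ?nnegrE//; [exact: ltW|rewrite divr_ge0// ltW].
have ba i : (i < k)%N -> b' i = a' i by move=> /ab.
apply: le_trans (qval_dist_le u1 Hb.1 Ha.1 ba) _.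
have -> : M%:R / (u - 1) / u ^+ k =
    M%:R / (u - 1) * u / c `^ al * (c `^ al / u ^+ k.+1).
  by rewrite exprS; field; rewrite !gt_eqF ?exprn_gt0.
apply: ler_pM => //.
- by rewrite !(divr_ge0, mulr_ge0)// ltW.
- by rewrite divr_ge0 ?exprn_ge0 ?ltW.
by rewrite ler_pM2r ?invr_gt0// ler_pM2r// ler_pM2r ?invr_gt0// ler_nat.
Qed.

(** * Greedy expansions *)

Lemma qval_split (R : realType) (t : R) M (a : nat -> nat) n : 1 < t ->
  (forall i, a i <= M)%N ->
  qval t a = series (fun i => (a i)%:R / t ^+ i.+1) n +
             qval t (fun j => a (n + j)%N) / t ^+ n.
Proof.
move=> t1; have t0 : t != 0 by rewrite gt_eqF ?(lt_trans ltr01).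
elim: n a => [|n IH] a aM; first by rewrite /series/= big_geq// add0r divr1.
rewrite (qval_recl t1 aM) psum_recl// (IH (fun i => a i.+1))//.
by rewrite addrA mulrDl exprSr invfM mulrA.
Qed.

Lemma ceilpE (R : realType) (r : R) : 1 < r -> ceilp r = (ceilp r).-1.+1.
Proof.
move=> r1; rewrite prednK// /ceilp absz_gt0 gt_eqF// ceil_gt0.
exact: lt_trans r1.
Qed.

(** Equivalently, the right end of [Jp r] is at least 1. Hence a gap of one unit can be filled by
    later digits, and $[0,1]$ lies in [Jp r]. *)
Lemma ceilp_pred_ge (R : realType) (r : R) : 1 < r -> r - 1 <= (ceilp r).-1%:R.
Proof.
move=> r1; rewrite lerBlDr natr1 -ceilpE// /ceilp.
rewrite -[_%:R]/((Posz `|Num.ceil r|)%:~R) gez0_abs ?ceil_ge//.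
by rewrite ltW// ceil_gt0 (lt_trans ltr01).
Qed.

Lemma digits_val_rcons (R : realType) (p : R) s k :
  digits_val p (rcons s k) = digits_val p s + k%:R / p ^+ (size s).+1.
Proof.
rewrite /digits_val size_rcons big_ord_recr /= nth_rcons ltnn eqxx.
by congr (_ + _); apply: eq_bigr => i _; rewrite nth_rcons ltn_ord.
Qed.

Lemma size_greedy_prefix (R : realType) (p x : R) n :
  size (greedy_prefix p x n) = n.
Proof. by elim: n => //= n IH; rewrite size_rcons IH. Qed.

Lemma greedy_prefixS (R : realType) (p x : R) n :
  greedy_prefix p x n.+1 = rcons (greedy_prefix p x n) (greedy_digit p x n).
Proof.
rewrite /greedy_digit /= nth_rcons size_greedy_prefix ltnn eqxx//.
Qed.

(** The digit 0 always qualifies, so the maximum in [greedy_next] runs over a nonempty set and is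
    attained; by maximality the next digit, if there is one, overshoots [x]. *)
Lemma greedy_nextP (R : realType) (p x : R) s : 1 < p -> digits_val p s <= x ->
  [/\ (greedy_next p x s <= (ceilp p).-1)%N,
      digits_val p (rcons s (greedy_next p x s)) <= x &
      (greedy_next p x s < (ceilp p).-1)%N ->
        x < digits_val p (rcons s (greedy_next p x s).+1)].
Proof.
move=> p1 sx; have cp := ceilpE p1.
have c0 : (0 < ceilp p)%N by rewrite cp.
pose P := [pred k : 'I_(ceilp p) | digits_val p (rcons s k) <= x].
have P0 : P (Ordinal c0) by rewrite /= digits_val_rcons mul0r addr0.
have P1 : (0 < #|P|)%N by apply/card_gt0P; exists (Ordinal c0).
have [k Pk ek] := eq_bigmax_cond (fun k : 'I_(ceilp p) => k : nat) P1.
have {}ek : greedy_next p x s = k by [].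
rewrite ek; split => //; first by rewrite -ltnS (leq_trans (ltn_ord k)) ?(eq_leq cp).
move=> kM; rewrite ltNge; apply/negP => kx.
have kc : (k.+1 < ceilp p)%N by rewrite (leq_trans _ (eq_leq (esym cp))) ?ltnS.
have := @leq_bigmax_cond _ P (fun k : 'I_(ceilp p) => k : nat) (Ordinal kc) kx.
by rewrite -[X in (_ <= X)%N]/(greedy_next p x s) ek /= ltnn.
Qed.

Section Greedy.
Variables (R : realType) (r x : R).
Hypotheses (r1 : 1 < r) (xJ : Jp r x).
Let M := (ceilp r).-1.
Let v n := digits_val r (greedy_prefix r x n).
Let b := greedy_digit r x.

Let r0 : 0 < r. Proof. exact: lt_trans r1. Qed.

Let vS n : v n.+1 = v n + (b n)%:R / r ^+ n.+1.
Proof. by rewrite /v greedy_prefixS digits_val_rcons size_greedy_prefix. Qed.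

Let v_series n : v n = series (fun i => (b i)%:R / r ^+ i.+1) n.
Proof.
elim: n => [|n IH]; last by rewrite seriesSr -IH vS.
by rewrite /v /series /digits_val /= big_ord0 big_geq.
Qed.

(** The rescaled remainder stays in [Jp r]. If the new digit is below [M], the remainder is under
    $r^{-(n+1)}$ and [ceilp_pred_ge] applies; if it is [M], the identity $rM/(r-1) = M + M/(r-1)$
    carries the bound over. *)
Let v_bound n : v n <= x <= v n + M%:R / (r - 1) / r ^+ n.
Proof.
have r10 : 0 < r - 1 by rewrite subr_gt0.
elim: n => [|n /andP[vx xv]].
  move: xJ => /andP[x0]; rewrite ceilpE// -natr1 addrK -/M => xM.
  by rewrite /v /digits_val /= big_ord0 x0 add0r expr0 divr1.
have [kM vx' xlt] := greedy_nextP r1 vx.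
have ek : greedy_next r x (greedy_prefix r x n) = b n.
  by rewrite /b /greedy_digit /= nth_rcons size_greedy_prefix ltnn eqxx.
move: kM vx' xlt; rewrite ek !digits_val_rcons size_greedy_prefix -/(v n).
move=> kM vx' xlt; rewrite vS vx' /=.
have rn0 : 0 < r ^+ n.+1 by rewrite exprn_gt0.
have [bM|bM] := ltnP (b n) M.
  rewrite (le_trans (ltW (xlt bM)))// -natr1 mulrDl addrA lerD2l.
  rewrite ler_pM2r ?invr_gt0// ler_pdivlMr// mul1r; exact: ceilp_pred_ge.
have -> : b n = M by apply/eqP; rewrite eqn_leq kM bM.
rewrite (le_trans xv)// -addrA lerD2l exprS; rewrite le_eqVlt; apply/orP; left.
by apply/eqP; field; rewrite !gt_eqF ?exprn_gt0.
Qed.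

Lemma greedy_digit_le i : (greedy_digit r x i <= (ceilp r).-1)%N.
Proof.
have /andP[vx _] := v_bound i; have [+ _ _] := greedy_nextP r1 vx.
by rewrite /greedy_digit /= nth_rcons size_greedy_prefix ltnn eqxx.
Qed.

Lemma qval_greedy : qval r (greedy_digit r x) = x.
Proof.
apply: cvg_lim => //; rewrite -/b.
apply: (@squeeze_cvgr _ _ _ _ (fun n => x - geometric (M%:R / (r - 1)) r^-1 n) (fun=> x)).
- near=> n; rewrite -v_series /geometric/= exprVn lerBlDr andbC.
  exact: v_bound.
- rewrite -[X in _ --> X]subr0; apply: cvgB; first exact: cvg_cst.
  by apply: cvg_geometric; rewrite gtr0_norm ?invr_gt0// invf_lt1.
- exact: cvg_cst.
Unshelve. all: by end_near. Qed.

(** If digit [k] is not maximal, raising it by one overshoots [x], so the remainder after it is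
    below $r^{-(k+1)}$; that remainder is the tail value divided by $r^{k+1}$. *)
Lemma adm_greedy : adm (ceilp r).-1 r (greedy_digit r x).
Proof.
split=> [|k kM]; first exact: greedy_digit_le.
have rk0 : 0 < r ^+ k.+1 by rewrite exprn_gt0.
rewrite -(@ler_pM2r _ (r ^+ k.+1)^-1) ?invr_gt0// -(lerD2l (v k.+1)).
rewrite {1}v_series -(qval_split _ r1 greedy_digit_le) qval_greedy.
have /andP[vx _] := v_bound k; have [_ _] := greedy_nextP r1 vx.
have -> : greedy_next r x (greedy_prefix r x k) = b k.
  by rewrite /b /greedy_digit /= nth_rcons size_greedy_prefix ltnn eqxx.
move=> /(_ kM)/ltW; rewrite digits_val_rcons size_greedy_prefix -/(v k).
by rewrite vS -natr1 mulrDl addrA.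
Qed.

End Greedy.

(** * Hausdorff measure of Hölder images *)

Lemma natr_powRN_small (R : realType) (g e : R) : 0 < g -> 0 < e ->
  exists N0, forall N, (N0 <= N)%N -> N%:R `^ (- g) <= e.
Proof.
move=> g0 e0; exists (Num.bound (e^-1 `^ g^-1)).+1 => N leN.
have N0 : 0 < N%:R :> R by rewrite ltr0n (leq_trans _ leN).
rewrite powRN invf_ple ?posrE ?powR_gt0//.
have -> : e^-1 = (e^-1 `^ g^-1) `^ g.
  by rewrite -powRrM mulVf ?gt_eqF// powRr1// invr_ge0 ltW.
apply: ge0_ler_powR; rewrite ?nnegrE ?powR_ge0 ?ltW//.
rewrite (lt_trans (archi_boundP _)) ?powR_ge0// ltr_nat.
exact: leq_trans leN.
Qed.

Lemma rdiam_le (R : realType) (U : set R) d : 0 <= d ->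
  (forall x y, U x -> U y -> `|x - y| <= d) -> rdiam U <= d.
Proof.
move=> d0 Ud; have [[z]|ne] := pselect ([set `|x - y| | x in U & y in U] !=set0).
  by move=> Uz; apply: ge_sup; [exists z|move=> _ [x Ux [y Uy <-]]; exact: Ud].
(* With no distances at all, [sup] takes its default value 0. *)
suff -> : rdiam U = 0 by [].
by apply: sup_out => -[].
Qed.

(** An unbounded set of distances would have the default supremum 0; the bound [d], which every
    member of a [delta_cover] has, excludes this. *)
Lemma le_rdiam (R : realType) (U : set R) d :
  (forall x y, U x -> U y -> `|x - y| <= d) ->
  forall x y, U x -> U y -> `|x - y| <= rdiam U.
Proof.
move=> Ud x y Ux Uy; apply: ub_le_sup; last by exists x => //; exists y.
by exists d => _ [x' Ux' [y' Uy' <-]]; exact: Ud.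
Qed.

Lemma rdiam_ge0 (R : realType) (U : set R) : 0 <= rdiam U.
Proof.
rewrite /rdiam; have [[[z [x Ux [y Uy exy]]] ub]|/sup_out->//] :=
  pselect (has_sup [set `|x - y| | x in U & y in U]).
by apply: (@le_trans _ _ `|x - y|) => //; apply: ub_le_sup => //;
   exists x => //; exists y.
Qed.

Lemma lebesgue_measure_cball (R : realType) (y d : R) : 0 <= d ->
  lebesgue_measure (`[y - d, y + d]%classic : set R) = (2 * d)%:E.
Proof.
move=> d0; rewrite lebesgue_measure_itv /= lte_fin.
case: ltP => h; first by rewrite -EFinB; congr EFin; lra.
by congr EFin; lra.
Qed.

(** A quantitative form of: the upper box dimension of [A] is at most [1 / al]. *)
Definition thin_cover (R : realType) (al : R) (A : set R) : Prop :=
  exists2 C : R, 0 < C & forall N, (0 < N)%N -> exists c : nat -> R,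
    forall x, A x -> exists2 i, (i < N)%N & `|x - c i| <= C * N%:R `^ (- al).

(** Cut $[0,K)$ into [N] cells of length $K/N$. Points whose [g]-values share a cell have [f]-values
    within $C (K/N)^{al}$, so the [f]-value of any one of them serves as centre. *)
Lemma thin_cover_holder (R : realType) (T : Type) (S : set T) (f g : T -> R)
    (C K al : R) : 0 < C -> 0 < K -> 0 <= al ->
  (forall a, S a -> 0 <= g a < K) ->
  (forall a b, S a -> S b -> `|f a - f b| <= C * `|g a - g b| `^ al) ->
  thin_cover al (f @` S).
Proof.
move=> C0 K0 al0 gK fg; exists (C * K `^ al); first by rewrite mulr_gt0 ?powR_gt0.
move=> N N0; have NR0 : 0 < N%:R :> R by rewrite ltr0n.
pose idx a := Num.truncn (g a * (N%:R / K)).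
have NK0 : 0 < N%:R / K by rewrite divr_gt0.
have /choice[c cP] : forall i, exists c, forall a, S a -> idx a = i ->
    `|f a - c| <= C * K `^ al * N%:R `^ (- al).
  move=> i; have [[b Sb bi]|ne] := pselect (exists2 b, S b & idx b = i).
    exists (f b) => a Sa ai; rewrite (le_trans (fg _ _ Sa Sb))//.
    rewrite -mulrA ler_wpM2l ?(ltW C0)// powRN.
    have -> : K `^ al / N%:R `^ al = (K / N%:R) `^ al.
      have {1}-> : K = K / N%:R * N%:R by rewrite divfK// gt_eqF.
      by rewrite powRM ?divr_ge0 ?ltW// mulfK// gt_eqF// powR_gt0.
    apply: ge0_ler_powR; rewrite ?nnegrE ?divr_ge0 ?(ltW K0)//.
    have /andP[ga _] := gK _ Sa; have /andP[gb _] := gK _ Sb.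
    have /truncn_itv/andP[] : 0 <= g a * (N%:R / K) by rewrite mulr_ge0// ltW.
    have /truncn_itv/andP[] : 0 <= g b * (N%:R / K) by rewrite mulr_ge0// ltW.
    rewrite -/(idx a) -/(idx b) ai bi -natr1 => h1 h2 h3 h4.
    have -> : K / N%:R = (N%:R / K)^-1 by rewrite invfM invrK mulrC.
    rewrite -[leRHS]mul1r ler_pdivlMr// -[X in _ * X](gtr0_norm NK0) -normrM.
    by rewrite mulrBl ler_norml; apply/andP; split; lra.
  by exists 0 => a Sa ai; exfalso; apply: ne; exists a.
exists c => _ [a Sa <-]; exists (idx a); last exact: (cP (idx a)).
have /andP[ga gaK] := gK _ Sa.
rewrite truncn_lt_nat; last by rewrite mulr_ge0// ltW.
by rewrite mulrA ltr_pdivrMr// mulrC ltr_pM2l.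
Qed.

(** [N] pieces of diameter at most $2CN^{-al}$ contribute at most $(2C)^s N^{1 - al s}$, which tends
    to 0. *)
Lemma thin_cover_hausdorff (R : realType) (al s : R) (A : set R) :
  0 < al -> 0 < s -> 1 < al * s -> thin_cover al A ->
  hausdorff_measure s A = 0%E.
Proof.
move=> al0 s0 als [C C0 cov].
have ser0 (U : nat -> set R) : (0 <= \sum_(0 <= n <oo) ((rdiam (U n)) `^ s)%:E)%E.
  by apply: nneseries_ge0 => n _ _; rewrite lee_fin powR_ge0.
suff cont0 delta : 0 < delta -> hausdorff_content s delta A = 0%E.
  apply/eqP; rewrite eq_le; apply/andP; split.
    by apply: ge_ereal_sup => _ [d d0 <-]; rewrite cont0.
  by apply: ereal_sup_ubound; exists 1; [exact: ltr01|exact: cont0].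
move=> d0; apply/eqP; rewrite eq_le; apply/andP; split; last first.
  by apply: le_ereal_inf_tmp => _ [U _ <-].
apply/lee_addgt0Pr => e e0; rewrite add0e.
have C2 : 0 < 2 * C by rewrite mulr_gt0.
have C2s : 0 < (2 * C) `^ s by rewrite powR_gt0.
have [N1 N1P] := natr_powRN_small al0 (divr_gt0 d0 C2).
have als1 : 0 < al * s - 1 by rewrite subr_gt0.
have [N2 N2P] := natr_powRN_small als1 (divr_gt0 e0 C2s).
(* Beyond [N1] the pieces have diameter at most [delta]; beyond [N2] the sum is at most [e]. *)
pose N := (N1 + N2).+1.
have {}N1P : 2 * C * N%:R `^ (- al) <= delta.
  by rewrite mulrC -ler_pdivlMr// N1P// /N -addnS leq_addr.
have {}N2P : (2 * C) `^ s * N%:R `^ (- (al * s - 1)) <= e.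
  by rewrite mulrC -ler_pdivlMr// N2P// /N -addSn leq_addl.
have [c cP] := cov N isT.
pose r := C * N%:R `^ (- al).
have r0 : 0 <= r by rewrite mulr_ge0 ?powR_ge0 ?ltW.
pose U n := [set x | (n < N)%N /\ `|x - c n| <= r].
have diamU n x y : U n x -> U n y -> `|x - y| <= 2 * r.
  move=> [_ xc] [_ yc]; rewrite -(subrKA (c n)) (le_trans (ler_normD _ _))//.
  rewrite [X in _ + X]distrC; lra.
apply: (@le_trans _ _ (\sum_(0 <= n <oo) ((rdiam (U n)) `^ s)%:E)%E).
  apply: ereal_inf_lbound; exists U => //; split.
    by move=> x /cP[i iN xi]; exists i.
  move=> n x y Ux Uy; rewrite (le_trans (diamU _ _ _ Ux Uy))//.
  by rewrite /r mulrA.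
rewrite (@nneseries_split _ _ 0 N); last by move=> k _; rewrite lee_fin powR_ge0.
(* From index [N] on, [U] is empty and has diameter 0, and $0^s = 0$ because $s > 0$. *)
rewrite eseries0 ?adde0; last first.
  move=> i iN _; suff -> : rdiam (U i) = 0 by rewrite powR0 ?gt_eqF.
  apply/eqP; rewrite eq_le rdiam_ge0 andbT; apply: rdiam_le => // x y [+ _].
  by rewrite ltnNge iN.
rewrite add0n sumEFin lee_fin (le_trans _ N2P)//.
apply: (@le_trans _ _ (\sum_(0 <= k < N) (2 * r) `^ s)).
  have r20 : 0 <= 2 * r by rewrite mulr_ge0.
  apply: ler_sum => i _; apply: ge0_ler_powR; rewrite ?nnegrE ?rdiam_ge0 ?(ltW s0)//.
  by apply: rdiam_le => //; exact: diamU.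
rewrite big_const_nat subn0 iter_addr_0 -[leLHS]mulr_natr /r mulrA powRM ?powR_ge0 ?(ltW C2)//.
rewrite -powRrM -mulrA ler_wpM2l ?powR_ge0//.
rewrite -{2}[N%:R]powRr1 ?ler0n// -powRD; last by apply/implyP; rewrite pnatr_eq0.
by rewrite mulNr opprB addrC.
Qed.

(** The covers are finite, so their unions of closed intervals are closed and contain the closure of
    [A] too; their total length is at most $2CN^{1-al}$. *)
Lemma thin_cover_null (R : realType) (al : R) (A : set R) : 1 < al ->
  thin_cover al A -> lebesgue_measure (closure A) = 0%E.
Proof.
move=> al1 [C C0 cov]; apply/eqP; rewrite eq_le measure_ge0 andbT.
apply/lee_addgt0Pr => e e0; rewrite add0e.
have C2 : 0 < 2 * C by rewrite mulr_gt0.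
have als1 : 0 < al - 1 by rewrite subr_gt0.
have [N1 N1P] := natr_powRN_small als1 (divr_gt0 e0 C2).
pose N := N1.+1.
have {}N1P : 2 * C * N%:R `^ (- (al - 1)) <= e.
  by rewrite mulrC -ler_pdivlMr// N1P// /N.
have [c cP] := cov N isT.
pose r := C * N%:R `^ (- al).
have r0 : 0 <= r by rewrite mulr_ge0 ?powR_ge0 ?ltW.
pose F i := `[c i - r, c i + r]%classic.
have AF : closure A `<=` \big[setU/set0]_(i < N) F i.
  have /closure_id -> : closed (\big[setU/set0]_(i < N) F i).
    by apply: closed_bigsetU => i _; exact: itv_closed.
  apply: closureS => x /cP[i iN xi].
  rewrite -bigcup_mkord; exists i => //=.
  move: xi; rewrite -/r ler_norml /F /= in_itv/= => /andP[h1 h2].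
  by apply/andP; split; lra.
have mF k : `I_N k -> measurable (F k) by move=> _; exact: measurable_itv.
have mA : measurable (closure A).
  by apply: closed_measurable; exact: closed_closure.
apply: (le_trans (content_subadditive lebesgue_measure mF mA AF)).
rewrite (eq_bigr (fun=> (2 * r)%:E)); last by move=> i _; exact: lebesgue_measure_cball.
rewrite sumEFin lee_fin (le_trans _ N1P)//.
rewrite big_const_ord iter_addr_0 -[leLHS]mulr_natr /r mulrA -[leLHS]mulrA.
rewrite ler_wpM2l ?(ltW C2)//.
rewrite -{2}[N%:R]powRr1 ?ler0n// -powRD; last by apply/implyP; rewrite pnatr_eq0.
by rewrite opprB addrC.
Qed.

Lemma nowhere_dense_null (R : realType) (A : set R) :
  lebesgue_measure (closure A) = 0%E -> nowhere_dense A.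
Proof.
move=> A0; rewrite /nowhere_dense -subset0 => x /= /nbhs_ballP[e /= e0 exA].
have : (lebesgue_measure (ball x e) <= lebesgue_measure (closure A))%E.
  apply: le_measure => //; rewrite ?inE.
  - exact: measurable_ball.
  - by apply: closed_measurable; exact: closed_closure.
by rewrite A0 lebesgue_measure_ball ?(ltW e0)// lee_fin leNgt pmulrn_lgt0// e0.
Qed.

(** A cover of [A] by sets of diameter $d_n \le 1$ is carried by the Hölder condition to a cover of
    $[0,1]$ by intervals of length $2C d_n^s$. Hence $1 \le 2C \sum d_n^s \le 2C \sum d_n^t$. *)
Lemma hausdorff_measure_neq0 (R : realType) (T : Type) (S : set T)
    (f g : T -> R) (C s t : R) (A : set R) :
  0 < C -> 0 < s -> t <= s ->
  f @` S `<=` A -> `[0, 1] `<=` g @` S ->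
  (forall a b, S a -> S b -> `|g a - g b| <= C * `|f a - f b| `^ s) ->
  hausdorff_measure t A <> 0%E.
Proof.
move=> C0 s0 ts fA g01 gf H0.
suff : ((2 * C)^-1%:E <= hausdorff_content t 1 A)%E.
  have C2 : 0 < (2 * C)^-1 by rewrite invr_gt0 mulr_gt0.
  move=> h; have : ((2 * C)^-1%:E <= hausdorff_measure t A)%E.
    by apply: (le_trans h); apply: ereal_sup_ubound; exists 1 => //; exact: ltr01.
  by rewrite H0 lee_fin leNgt C2.
apply: le_ereal_inf_tmp => _ [U [AU Ud] <-].
rewrite -[leLHS]mule1 lee_pdivrMl ?mulr_gt0//.
pose r n := C * rdiam (U n) `^ s.
have r0 n : 0 <= r n by rewrite mulr_ge0 ?powR_ge0 ?ltW.
have /choice[y yP] : forall n, exists y, forall a, S a -> U n (f a) ->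
    `|g a - y| <= r n.
  move=> n.
  have [[b [Sb Ub]]|ne] := pselect (exists b, S b /\ U n (f b)).
    exists (g b) => a Sa Ua; rewrite (le_trans (gf _ _ Sa Sb))// ler_wpM2l ?(ltW C0)//.
    apply: ge0_ler_powR; rewrite ?nnegrE ?rdiam_ge0 ?(ltW s0)//.
    exact: (le_rdiam (Ud n)).
  by exists 0 => a Sa Ua; exfalso; apply: ne; exists a.
pose F n := (`[y n - r n, y n + r n]%classic : set R).
have cover : (`[0, 1]%classic : set R) `<=` \bigcup_n F n.
  move=> z /g01[a Sa <-]; have [|n _ Un] := AU (f a); first by apply: fA; exists a.
  exists n => //=; have := yP n a Sa Un.
  rewrite ler_norml /F /= in_itv/= => /andP[h1 h2].
  by apply/andP; split; lra.
have mu01 : lebesgue_measure (`[0, 1]%classic : set R) = 1%E.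
  by rewrite lebesgue_measure_itv /= lte_fin ltr01 sube0.
have mF n : measurable (F n) by exact: measurable_itv.
have : (1 <= \sum_(0 <= n <oo) lebesgue_measure (F n))%E.
  rewrite -mu01.
  exact: (measure_sigma_subadditive lebesgue_measure mF (measurable_itv _) cover).
move/le_trans; apply.
rewrite (eq_eseriesr (g := fun n => ((2 * C)%:E * (rdiam (U n) `^ s)%:E)%E)); last first.
  by move=> n _; rewrite -EFinM -mulrA; exact: lebesgue_measure_cball.
rewrite nneseriesZl; last by move=> i _; rewrite lee_fin powR_ge0.
rewrite lee_pmul2l ?lte_fin ?mulr_gt0//.
apply: lee_nneseries => [n _ _|n _]; first by rewrite lee_fin powR_ge0.
(* Powers decrease in the exponent only for a base in $(0,1]$; for diameter 0 the left side vanishes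
   since $s > 0$. *)
rewrite lee_fin; have [->|d0] := eqVneq (rdiam (U n)) 0.
  by rewrite powR0 ?gt_eqF// powR_ge0.
apply: ger_powR => //; rewrite lt_def d0 rdiam_ge0/=.
by apply: rdiam_le => //; exact: Ud.
Qed.

Lemma hausdorff_dim_eq (R : realType) (d : R) (A : set R) : 0 <= d ->
  (forall s, d < s -> hausdorff_measure s A = 0%E) ->
  (forall s, 0 <= s < d -> hausdorff_measure s A <> 0%E) ->
  hausdorff_dim A = d.
Proof.
move=> d0 up low; apply/eqP; rewrite eq_le; apply/andP; split.
  apply/ler_addgt0Pr => e e0; apply: ge_inf; first by exists 0 => s [].
  by split; [rewrite addr_ge0// ltW|apply: up; rewrite ltrDl].
apply: lb_le_inf; first by exists (d + 1); split; [lra|apply: up; lra].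
by move=> s [s0 As]; rewrite leNgt; apply/negP => sd; apply: (low s); rewrite ?s0.
Qed.

(** * Dimension and size of the sets [Grq r q] and [Gq q] *)

(** Lets countably many bases [p] below [q] absorb all bases [r] below [q]. *)
Lemma adm_base (R : realType) M (r p : R) a : 1 < r -> r <= p ->
  adm M r a -> adm M p a.
Proof.
move=> r1 rp [aM aP]; split=> // k kM.
have p0 : 0 < p by rewrite (lt_le_trans _ rp)// (lt_trans ltr01).
apply: (le_trans (@qval_base _ r p M _ r1 rp _)) => //.
rewrite (le_trans (ler_wpM2l _ (aP k kM)))//.
  by rewrite divr_ge0// ltW// (lt_trans ltr01).
by rewrite mulr1 ler_pdivrMr// mul1r.
Qed.

Lemma thin_cover_adm (R : realType) M (p t q : R) : 1 < p -> p < t -> 1 < q ->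
  thin_cover (ln q / ln t) [set qval q a | a in adm M p].
Proof.
move=> p1 pt q1; have t1 := lt_trans p1 pt; have t10 : 0 < t - 1 by rewrite subr_gt0.
have [C C0 hol] := adm_holder M p1 pt q1.
(* The base-[t] value is the parameter; [M.+1] makes its upper bound strict. *)
apply: (@thin_cover_holder _ _ _ _ (qval t) C (M.+1%:R / (t - 1))) => //.
- by rewrite divr_gt0.
- by rewrite divr_ge0 ?ln_ge0// ltW.
move=> a [aM _]; rewrite (qval_ge0 t1 aM) (le_lt_trans (qval_le t1 aM))//.
by rewrite ltr_pM2r ?invr_gt0// ltr_nat.
Qed.

Lemma Grq_sub_adm (R : realType) (r q : R) : 1 < r ->
  Grq r q `<=` [set qval q a | a in adm (ceilp r).-1 r].
Proof.
by move=> r1 _ [x xJ ->]; exists (greedy_digit r x) => //; exact: adm_greedy.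
Qed.

(** The superset [A] allows the same bound to serve for [Grq r q] and for the union [Gq q]. *)
Lemma hausdorff_measure_Grq_neq0 (R : realType) (r q s : R) (A : set R) :
  1 < r -> r < q -> s <= ln r / ln q -> Grq r q `<=` A ->
  hausdorff_measure s A <> 0%E.
Proof.
move=> r1 rq sd GA; have q1 := lt_trans r1 rq.
have [C C0 hol] := adm_holder (ceilp r).-1 r1 rq r1.
apply: (@hausdorff_measure_neq0 _ _ [set greedy_digit r x | x in Jp r]
  (qval q) (qval r) C (ln r / ln q) s A) => //.
- by rewrite divr_gt0 ?ln_gt0.
- by move=> _ [_ [x xJ <-] <-]; apply: GA; exists x.
- move=> x /=; rewrite in_itv /= => /andP[x0 x1].
  have xJ : Jp r x.
    rewrite /Jp /= x0 (le_trans x1)// ler_pdivlMr ?subr_gt0// mul1r.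
    by rewrite ceilpE// -natr1 addrK ceilp_pred_ge.
  by exists (greedy_digit r x); [exists x|exact: qval_greedy].
- by move=> _ _ [x xJ <-] [y yJ <-]; apply: hol; exact: adm_greedy.
Qed.

Lemma hausdorff_dim_Grq (R : realType) (r q : R) : 1 < r -> r < q ->
  hausdorff_dim (Grq r q) = ln r / ln q.
Proof.
move=> r1 rq; have q1 := lt_trans r1 rq.
have [lr lq] := (ln_gt0 r1, ln_gt0 q1).
have d0 : 0 < ln r / ln q by rewrite divr_gt0.
apply: hausdorff_dim_eq => [|s ds|s /andP[_ /ltW sd]]; first exact: ltW.
(* Here $t = q^h$, so the covering exponent is $1/h$. As [h] lies strictly between $\ln r/\ln q$ and
   [s], both $t > r$ and $s/h > 1$ hold. *)
- pose h := (s + ln r / ln q) / 2; pose t := expR (ln q * h).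
  have lt : ln t = ln q * h by rewrite expRK.
  have h0 : 0 < h by rewrite /h; lra.
  have rt : r < t.
    rewrite -ltr_ln ?posrE ?expR_gt0 ?(lt_trans ltr01)// lt mulrC.
    by rewrite -ltr_pdivrMr// /h; lra.
  have al : ln q / ln t = h^-1 by rewrite lt; field; rewrite !gt_eqF.
  have := @thin_cover_adm _ (ceilp r).-1 r t q r1 rt q1.
  rewrite al => -[C C0 cov].
  apply: (@thin_cover_hausdorff _ h^-1); [by rewrite invr_gt0|exact: lt_trans ds| |].
    by rewrite mulrC ltr_pdivlMr// mul1r /h; lra.
  exists C => // N N0; have [c cP] := cov N N0.
  by exists c => x /Grq_sub_adm-/(_ r1); exact: cP.
- exact: hausdorff_measure_Grq_neq0 sd _.
Qed.

Lemma hausdorff_dim_Gq (R : realType) (q : R) : 1 < q -> hausdorff_dim (Gq q) = 1.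
Proof.
move=> q1; have q10 : 0 < q - 1 by rewrite subr_gt0.
have lq := ln_gt0 q1.
apply: hausdorff_dim_eq => // [s s1|s /andP[s0 s1]].
  apply: (@thin_cover_hausdorff _ 1) => //; first exact: lt_trans s1.
    by rewrite mul1r.
  (* The set is bounded, so the identity, being 1-Hölder, yields a thin cover of exponent 1. The
     bound is uniform in [r] because digits in base [r] are less than [ceilp q]. *)
  rewrite -[Gq q]image_id.
  apply: (@thin_cover_holder _ _ _ _ id 1 ((ceilp q)%:R / (q - 1))) => //.
  - by rewrite divr_gt0// ceilpE// ltr0n.
  - move=> _ [r /= /andP[r1 rq] /Grq_sub_adm-/(_ r1)[a [aM _] <-]].
    rewrite (qval_ge0 q1 aM) (le_lt_trans (qval_le q1 aM))//.
    rewrite ltr_pM2r ?invr_gt0// ltr_nat -ltnS -ceilpE//.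
    rewrite ltnS /ceilp -lez_nat !gez0_abs ?le_ceil ?ltW//.
    - by rewrite ceil_gt0 (lt_trans ltr01).
    - by rewrite ceil_gt0 (lt_trans ltr01).
  - by move=> a b _ _; rewrite powRr1// mul1r.
(* Now $r = q^h$ with $s < h < 1$, so [Grq r q] already has dimension [h] above [s]. *)
pose h := (s + 1) / 2; pose r := expR (ln q * h).
have lr : ln r = ln q * h by rewrite expRK.
have r1 : 1 < r by rewrite -expR0 ltr_expR mulr_gt0// /h; lra.
have rq : r < q.
  rewrite -ltr_ln ?posrE ?expR_gt0 ?(lt_trans ltr01)// lr gtr_pMr// /h; lra.
apply: (hausdorff_measure_Grq_neq0 r1 rq).
  by rewrite lr mulrC mulKf ?gt_eqF// /h; lra.
by move=> y ry; exists r => //=; rewrite r1.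
Qed.

(** One countable family with null closures gives both first category and measure zero. It is
    indexed by coded pairs of a digit bound [M] and a base [p m]. *)
Lemma Gq_null_cover (R : realType) (q : R) : 1 < q ->
  exists F : nat -> set R, Gq q `<=` \bigcup_n F n /\
    forall n, lebesgue_measure (closure (F n)) = 0%E.
Proof.
move=> q1; have q10 : 0 < q - 1 by rewrite subr_gt0.
(* These bases increase to [q]; the shift by 2 keeps the first one above 1. *)
pose p m : R := q - (q - 1) / m.+2%:R.
have p1 m : 1 < p m.
  by rewrite /p ltrBrDr -ltrBrDl ltr_pdivrMr ?ltr0n// ltr_pMr// ltr1n.
have pq m : p m < q by rewrite /p ltrBlDr ltrDl divr_gt0// ltr0n.
exists (fun n => if unpickle n is Some (M, m)
                 then [set qval q a | a in adm M (p m)] else set0).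
split=> [y [r /= /andP[r1 rq]]|n].
  move=> /Grq_sub_adm-/(_ r1)[a aP <-].
  pose m := Num.bound ((q - 1) / (q - r)).
  exists (pickle ((ceilp r).-1, m)) => //; rewrite pickleK; exists a => //.
  apply: adm_base aP => //; have qr : 0 < q - r by rewrite subr_gt0.
  rewrite /p lerBrDr -lerBrDl.
  rewrite ler_pdivrMr ?ltr0n// mulrC -ler_pdivrMr//.
  rewrite ltW// (lt_le_trans (archi_boundP _)) ?divr_ge0 ?(ltW q10) ?(ltW qr)//.
  by rewrite ler_nat -addn2 leq_addr.
(* A base [t] strictly between [p m] and [q] gives the covering exponent $\ln q/\ln t > 1$. *)
case: unpickle => [[M m]|]; last by rewrite closure0 measure0.
pose t := (p m + q) / 2; have pt : p m < t by have := pq m; rewrite /t; lra.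
have tq : t < q by have := pq m; rewrite /t; lra.
have t1 : 1 < t := lt_trans (p1 m) pt.
apply: (@thin_cover_null _ (ln q / ln t)); last exact: thin_cover_adm.
by rewrite ltr_pdivlMr ?ln_gt0// mul1r ltr_ln// posrE (lt_trans ltr01).
Qed.

Theorem theorem2p7 (R : realType) (q : R) (hq : 1 < q) :
  (forall r : R, 1 < r < q -> hausdorff_dim (Grq r q) = ln r / ln q) /\
  (first_category (Gq q) /\
   (@lebesgue_measure R).-negligible (Gq q) /\
   hausdorff_dim (Gq q) = 1).
Proof.
split=> [r /andP[r1 rq]|]; first exact: hausdorff_dim_Grq.
have [F [GF F0]] := Gq_null_cover hq.
split; last split; last exact: hausdorff_dim_Gq.
  by exists F; split=> // n; exact: nowhere_dense_null.
have negF : (@lebesgue_measure R).-negligible (\bigcup_n F n).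
  apply: negligible_bigcup => n.
  exists (closure (F n)); split; [|exact: F0|exact: subset_closure].
  by apply: closed_measurable; exact: closed_closure.
exact: negligibleS negF.
Qed.
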